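(* Let $\mathcal{A}=\langle Q,q_0,\delta,\omega\rangle$ and $\mathcal{A}'=\langle Q',q_0',\delta',\omega'\rangle$ be two alternating EU parity tree automata (AAPTAs) over the same finite alphabet $\Sigma$. There exist AAPTAs $\mathcal{A}_\cup$ and $\mathcal{A}_\cap$ over $\Sigma$ such that $\mathcal{L}(\mathcal{A}_\cup)=\mathcal{L}(\mathcal{A})\cup\mathcal{L}(\mathcal{A}')$ and $\mathcal{L}(\mathcal{A}_\cap)=\mathcal{L}(\mathcal{A})\cap\mathcal{L}(\mathcal{A}')$, and each of them has size at most $\langle |Q|+|Q'|+1,\ |\delta|_B+|\delta'|_B+1,\ \max(|\delta|_E,|\delta'|_E),\ \max(|\delta|_U,|\delta'|_U),\ \max(|\omega|,|\omega'|)+1\rangle$.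
   Context: Multisets: a multiset over a set $S$ is a map $\mu:S\to\mathbb{N}$; $\mu\sqsubseteq\mu'$ iff $\mu(s)\le\mu'(s)$ for all $s$; $(\mu\ominus\mu')(s)=\max(0,\mu(s)-\mu'(s))$; $\mathrm{supp}(\mu)=\{s:\mu(s)>0\}$; $|\mu|=\sum_s\mu(s)$. An EU-pair over $S$ is a pair $\langle E;U\rangle$ with $E$ a finite multiset over $S$ and $U\subseteq S$; a multiset $\mu$ satisfies it if $E\sqsubseteq\mu$ and $\mathrm{supp}(\mu\ominus E)\subseteq U$. An EU-constraint over $S$ is a positive boolean formula built from $\top,\bot$, EU-pairs over $S$, $\wedge$ and $\vee$. Markings: a marking of a set $S'$ by $S$ is a map $\nu:S'\to 2^S$; a unitary submarking of $\nu$ is a map $\nu':S'\to S$ with $\nu'(s')\in\nu(s')$ for all $s'$ (it exists only if all $\nu(s')$ are nonempty); its image multiset is $s\mapsto|\{s'\in S':\nu'(s')=s\}|$. $\nu$ satisfies an EU-pair $\langle E;U\rangle$ if some unitary submarking of $\nu$ has an image multiset satisfying $\langle E;U\rangle$; this is extended to EU-constraints with $\top$ always and $\bot$ never satisfied, and $\wedge,\vee$ interpreted as usual (different conjuncts may use different submarkings). Trees: for a finite set $D$, a $D$-tree is a prefix-closed set $t\subseteq D^*$ (root $\varepsilon$); the successors of $n$ are the nodes $n\cdot d\in t$; a branch is a maximal sequence of nodes starting at the root, each a successor of the previous (finite ending in a leaf, or infinite). A $\Sigma$-labelled tree is $(t,l)$ with $t$ a $D$-tree for some finite $D$ and $l:t\to\Sigma$;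 nodes may have any finite number of successors. Automata: an AAPTA over a finite alphabet $\Sigma$ is $\mathcal{A}=\langle Q,q_0,\delta,\omega\rangle$ with $Q$ finite, $q_0\in Q$, $\delta:Q\times\Sigma\to$ EU-constraints over $Q$, and $\omega:Q\to\mathbb{N}$ a priority function. An execution tree of $\mathcal{A}$ over $\mathcal{T}=(t,l)$ ($t$ a $D$-tree) is a $(D\times Q)$-tree $\tau$ in which the node $(d_1,q_1)\cdots(d_k,q_k)$ is labelled $(d_1\cdots d_k,q_k)$ (with $d_1\cdots d_k\in t$) and the root is labelled $(\varepsilon,q_0)$, such that for each node $x$ labelled $(m,q)$, the marking $\nu_x$ of the successors of $m$ in $t$ given by $\nu_x(m\cdot d)=\{q':x\cdot(d,q')\in\tau\}$ satisfies $\delta(q,l(m))$. It is accepting if along every infinite branch the least priority $\omega(q)$ occurring infinitely often among the states $q$ of its nodes is even (finite branches are accepting). $\mathcal{L}(\mathcal{A})$ is the set of $\Sigma$-labelled trees that admit an accepting execution tree. Size: the size of $\mathcal{A}$ is the tuple $\langle |Q|,|\delta|_B,|\delta|_E,|\delta|_U,|\omega|\rangle$, where $|\delta|_B$ is the maximum size of the boolean formulas $\delta(q,\sigma)$, $|\delta|_E$ (resp. $|\delta|_U$) is the maximum of $|E|$ (resp. $|U|$) over EU-pairs $\langle E;U\rangle$ occurring in $\delta$, and $|\omega|=|\{\omega(q):q\in Q\}|$ is the number of priorities. ''Size at most'' is componentwise. *)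

(* Defs.v *)
From HB Require Import structures.
From mathcomp Require Import all_boot finmap multiset.
From mathcomp Require Import boolp classical_sets.

Set Implicit Arguments.
Unset Strict Implicit.
Unset Printing Implicit Defensive.

Local Open Scope nat_scope.

(* [eu_E] plays the role of E and [eu_U] that of U in the EU-pair <E; U>. *)
Record eu_pair (S : finType) := EUPair {
  eu_E : {mset S}%mset;
  eu_U : {set S} }.

Definition mset_sat (S : finType) (mu : {mset S}%mset) (p : eu_pair S) : Prop :=
  (eu_E p `<=` mu)%mset /\ {subset finsupp (mu `\` eu_E p)%mset <= eu_U p}.

Inductive eu_constraint (S : finType) : Type :=
| EUTop
| EUBot
| EUAtom of eu_pair S
| EUAnd of eu_constraint S & eu_constraint S
| EUOr of eu_constraint S & eu_constraint S.

Arguments EUTop {S}.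
Arguments EUBot {S}.

(* Number of nodes of the syntax tree; an EU-pair is a single leaf, whatever
   the cardinalities of its components. *)
Fixpoint formula_size (S : finType) (phi : eu_constraint S) : nat :=
  match phi with
  | EUTop | EUBot | EUAtom _ => 1
  | EUAnd phi1 phi2 | EUOr phi1 phi2 =>
      (formula_size phi1 + formula_size phi2).+1
  end.

Fixpoint eu_pairs (S : finType) (phi : eu_constraint S) : seq (eu_pair S) :=
  match phi with
  | EUTop | EUBot => [::]
  | EUAtom p => [:: p]
  | EUAnd phi1 phi2 | EUOr phi1 phi2 => eu_pairs phi1 ++ eu_pairs phi2
  end.

Definition marking (S' S : finType) := S' -> set S.

Definition unitary_submarking (S' S : finType) (nu : marking S' S)
    (nu' : S' -> S) : Prop :=
  forall s', nu s' (nu' s').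

(* The multiplicity of s is the number of s' such that nu' s' = s. *)
Definition image_mset (S' S : finType) (nu' : S' -> S) : {mset S}%mset :=
  seq_mset (codom nu').

Fixpoint marking_sat (S' S : finType) (nu : marking S' S)
    (phi : eu_constraint S) : Prop :=
  match phi with
  | EUTop => True
  | EUBot => False
  | EUAtom p =>
      exists nu', unitary_submarking nu nu' /\ mset_sat (image_mset nu') p
  | EUAnd phi1 phi2 => marking_sat nu phi1 /\ marking_sat nu phi2
  | EUOr phi1 phi2 => marking_sat nu phi1 \/ marking_sat nu phi2
  end.

(* Trees have a root, hence are nonempty. *)
Definition is_tree (D : finType) (t : set (seq D)) : Prop :=
  t [::] /\ forall m n, prefix m n -> t n -> t m.

Record ltree (Sigma : finType) := LTree {
  dir : finType;
  nodes : set (seq dir);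
  nodes_tree : is_tree nodes;
  label : nodes -> Sigma }.

Arguments nodes {Sigma} l _.

(* The successors of m, represented by their directions: d stands for the
   successor rcons m d. *)
Definition successors (D : finType) (t : set (seq D)) (m : seq D) : finType :=
  {d : D | rcons m d \in t}.

(* Every infinite sequence of successive nodes starting at the root is
   maximal. *)
Definition infinite_branch (D : finType) (t : set (seq D))
    (b : nat -> seq D) : Prop :=
  b 0 = [::] /\
  forall i, t (b i) /\ exists d : D, b i.+1 = rcons (b i) d.

Record aapta (Sigma : finType) := AAPTA {
  state : finType;
  init : state;
  trans : state -> Sigma -> eu_constraint state;
  prio : state -> nat }.

Section Semantics.
Variables (Sigma : finType) (A : aapta Sigma).

(* A node x = (d_1, q_1) ... (d_k, q_k) of an execution tree has the label
   (node_of x, state_of x) = (d_1 ... d_k, q_k), where q_k is to be read as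
   the initial state when k = 0. *)
Definition node_of (D : finType) (x : seq (D * state A)) : seq D := unzip1 x.

Definition state_of (D : finType) (x : seq (D * state A)) : state A :=
  last (init A) (unzip2 x).

Definition succ_marking (D : finType) (t : set (seq D))
    (tau : set (seq (D * state A))) (x : seq (D * state A)) :
    marking (successors t (node_of x)) (state A) :=
  fun d q' => tau (rcons x (val d, q')).

Arguments succ_marking {D} t tau x _ _.

Definition execution_tree (T : ltree Sigma)
    (tau : set (seq (dir T * state A))) : Prop :=
  is_tree tau /\
  forall x, tau x -> exists m : nodes T,
    val m = node_of x /\
    marking_sat (succ_marking (nodes T) tau x) (trans (state_of x) (label m)).

Definition infinitely_often (w : nat -> nat) (p : nat) : Prop :=
  forall n, exists i, n <= i /\ w i = p.

Definition least_infinitely_often (w : nat -> nat) (p : nat) : Prop :=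
  infinitely_often w p /\ forall p', infinitely_often w p' -> p <= p'.

Definition accepting (D : finType) (tau : set (seq (D * state A))) : Prop :=
  forall b, infinite_branch tau b ->
    exists p, least_infinitely_often (fun i => prio (state_of (b i))) p
      /\ ~~ odd p.

(* A predicate rather than a [set]: the universe of [ltree Sigma] lies above
   that of the carriers of [set], so equality of languages is stated
   extensionally. *)
Definition language : ltree Sigma -> Prop :=
  fun T => exists tau : set (seq (dir T * state A)),
    execution_tree tau /\ accepting tau.

Definition sizeB : nat :=
  \max_(q : state A) \max_(a : Sigma) formula_size (trans q a).

Definition sizeE : nat :=
  \max_(q : state A) \max_(a : Sigma)
    \max_(p <- eu_pairs (trans q a)) size (eu_E p).

Definition sizeU : nat :=
  \max_(q : state A) \max_(a : Sigma)
    \max_(p <- eu_pairs (trans q a)) #|eu_U p|.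

Definition num_prios : nat := size (undup (codom (@prio _ A))).

Definition aapta_size : nat * nat * nat * nat * nat :=
  (#|state A|, sizeB, sizeE, sizeU, num_prios).

End Semantics.

Definition size_at_most (s s' : nat * nat * nat * nat * nat) : Prop :=
  let: (q, b, e, u, w) := s in
  let: (q', b', e', u', w') := s' in
  [/\ q <= q', b <= b', e <= e', u <= u' & w <= w'].

(* Main.v *)
(** Both automata are embedded into the disjoint union of their state sets,
    extended with a fresh initial state whose formula is the disjunction (resp.
    conjunction) of the formulas of the two original initial states.  An
    EU-pair over one component forbids the states outside of it, so the
    execution trees of the combined automaton restrict to execution trees of
    the components, and conversely.

    To have few priorities, the priorities of each automaton are first
    compressed: merging consecutive priorities of equal parity and shifting
    down maps k priorities into {0, ..., k} while preserving order and parity,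
    so both compressed automata use priorities in
    {0, ..., max(|omega|, |omega'|)}. *)

Require Import Defs.
From mathcomp Require Import all_boot boolp classical_sets.
From mathcomp Require Import finmap multiset.

Set Implicit Arguments.
Unset Strict Implicit.
Unset Printing Implicit Defensive.

Local Open Scope nat_scope.

(** * Transporting EU-constraints along an injection *)

(** A state outside the range of [f] lies in neither component, so the lifted pair forbids it. *)
Definition lift_pair (S R : finType) (f : S -> R) (p : eu_pair S) : eu_pair R :=
  EUPair (seq_mset [seq f s | s <- eu_E p]) (f @: eu_U p).

Fixpoint lift (S R : finType) (f : S -> R) (phi : eu_constraint S) :
    eu_constraint R :=
  match phi with
  | EUTop => EUTop
  | EUBot => EUBot
  | EUAtom p => EUAtom (lift_pair f p)
  | EUAnd phi1 phi2 => EUAnd (lift f phi1) (lift f phi2)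
  | EUOr phi1 phi2 => EUOr (lift f phi1) (lift f phi2)
  end.

Lemma formula_size_lift (S R : finType) (f : S -> R) phi :
  formula_size (lift f phi) = formula_size phi.
Proof. by elim: phi => //= ? -> ? ->. Qed.

Lemma eu_pairs_lift (S R : finType) (f : S -> R) phi :
  eu_pairs (lift f phi) = [seq lift_pair f p | p <- eu_pairs phi].
Proof. by elim: phi => //= ? -> ? ->; rewrite map_cat. Qed.

Lemma size_lift_pair_E (S R : finType) (f : S -> R) p :
  size (eu_E (lift_pair f p)) = size (eu_E p).
Proof. by rewrite (perm_size (perm_eq_seq_mset _)) size_map. Qed.

Lemma lift_pair_E_inj (S R : finType) (f : S -> R) p s :
  injective f -> eu_E (lift_pair f p) (f s) = eu_E p s.
Proof.
move=> f_inj; rewrite mset_seqE count_map -count_mem_mset.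
by apply: eq_count => s' /=; rewrite (inj_eq f_inj).
Qed.

Lemma mset_satP (S : finType) (mu : {mset S}%mset) (p : eu_pair S) :
  mset_sat mu p <->
  forall s, eu_E p s <= mu s /\ (eu_E p s < mu s -> s \in eu_U p).
Proof.
split=> [[/msubsetP sub supp] s|sat].
  by split=> // lt; apply: supp; rewrite msuppE in_msetB.
split; first by apply/msubsetP => s; have [] := sat s.
by move=> s; rewrite msuppE in_msetB; have [_] := sat s.
Qed.

Lemma image_msetE (S' S : finType) (nu' : S' -> S) s :
  image_mset nu' s = #|[pred s' | nu' s' == s]|.
Proof.
by rewrite mset_seqE codomE count_map cardE size_filter -enumT; apply: eq_count.
Qed.

(** Constraints are positive, and a unitary submarking of a marking is also one of any larger
    marking. *)
Lemma marking_sat_mono (S' S : finType) (nu1 nu2 : marking S' S) phi :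
  (forall s' s, nu1 s' s -> nu2 s' s) ->
  marking_sat nu1 phi -> marking_sat nu2 phi.
Proof.
move=> sub; elim: phi => //= [p [nu' [nu'_sub sat]]|phi IH psi IH' []|].
- by exists nu'; split=> // s'; apply: sub.
- by move=> /IH sat /IH'.
- by move=> phi IH psi IH' [/IH|/IH']; [left|right].
Qed.

(** A submarking satisfying a lifted pair has its values in the range of [f], so it factors through
    [f]; injectivity then preserves multiplicities. *)
Lemma marking_sat_lift (S' S R : finType) (f : S -> R) (nu : marking S' R) phi :
  injective f ->
  marking_sat nu (lift f phi) <->
  marking_sat (fun s' s => nu s' (f s)) phi.
Proof.
move=> f_inj; elim: phi => //= [p|phi1 IH1 phi2 IH2|phi1 IH1 phi2 IH2];
  [|by rewrite IH1 IH2..].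
have image_f (nu' : S' -> S) s :
    image_mset (f \o nu') (f s) = image_mset nu' s.
  by rewrite !image_msetE; apply: eq_card => s'; rewrite !inE /= (inj_eq f_inj).
split=> [[nu' [nu'_sub /mset_satP sat]]|[nu' [nu'_sub /mset_satP sat]]].
  (* The multiplicity of a value of [nu'] is positive: either it exceeds that in the lifted [E] and
     the value lies in the image of [U], or the value occurs in the lifted [E]. *)
  have /choice [nu'' nu''E] : forall s', exists s, nu' s' = f s.
    move=> s'; have [_ inU] := sat (nu' s').
    have [/inU /imsetP[s _ ->]|] := ltnP (eu_E (lift_pair f p) (nu' s'))
      (image_mset nu' (nu' s')); first by exists s.
    have image_gt0 : 0 < image_mset nu' (nu' s').
      by rewrite image_msetE; apply/card_gt0P; exists s'; rewrite inE.
    move=> /(leq_trans image_gt0); rewrite mset_seqE -has_count.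
    by rewrite has_map => /hasP[s _ /eqP <-]; exists s.
  have {}nu''E : nu' = f \o nu'' by apply: funext.
  subst nu'.
  exists nu''; split=> //; apply/mset_satP => s.
  have := sat (f s); rewrite lift_pair_E_inj // image_f.
  by move=> [le inU]; split=> // /inU; rewrite mem_imset.
exists (f \o nu'); split=> //; apply/mset_satP => r.
(* Outside the range of [f] both multiplicities vanish. *)
have [[s ->]|r_out] := pselect (exists s, r = f s).
  rewrite lift_pair_E_inj // image_f; have [le inU] := sat s.
  by split=> // /inU; rewrite mem_imset.
have -> : image_mset (f \o nu') r = 0.
  rewrite image_msetE; apply: eq_card0 => s'; rewrite inE.
  by apply/eqP => fE; apply: r_out; exists (nu' s').
suff -> : eu_E (lift_pair f p) r = 0 by [].
rewrite mset_seqE; apply/count_memPn/mapP => -[s _ rE].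
by apply: r_out; exists s.
Qed.

(** * Priorities occurring infinitely often *)

(** Pigeonhole: [w] takes finitely many values, so one of those that [r] sends to [p'] recurs. *)
Lemma infinitely_often_fiber (r w : nat -> nat) (n p' : nat) :
  (forall i, w i < n) -> infinitely_often (r \o w) p' ->
  exists p, r p = p' /\ infinitely_often w p.
Proof.
move=> w_lt io; apply: contrapT => none.
have /choice [N NP] : forall p, exists N,
    r p = p' -> forall i, N <= i -> w i <> p.
  move=> p; apply: contrapT => noN; apply: none; exists p.
  split=> [|N]; apply: contrapT => H; apply: noN.
    by exists 0 => /H.
  by exists N => _ i le wi; apply: H; exists i.
have [i [le rw]] := io (\max_(p < n) N p).
apply: (NP (w i) rw i) => //; apply: leq_trans le.
by rewrite (leq_bigmax (Ordinal (w_lt i))).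
Qed.

Lemma least_infinitely_often_exists (w : nat -> nat) (n : nat) :
  (forall i, w i < n) -> exists p, least_infinitely_often w p.
Proof.
move=> w_lt.
(* The constant map makes 0 recur, so its fibre yields some recurring value of [w]. *)
have [|p [_ io]] := @infinitely_often_fiber (fun=> 0) w n 0 w_lt.
  by move=> m; exists m.
have ex : exists p, `[< infinitely_often w p >] by exists p; apply/asboolP.
exists (ex_minn ex); case: ex_minnP => q /asboolP q_io q_min.
by split=> // p' io'; apply/q_min/asboolP.
Qed.

Definition even_parity (w : nat -> nat) : Prop :=
  exists p, least_infinitely_often w p /\ ~~ odd p.

(** A monotone map sends the least recurring value to the least recurring value. The last hypothesis
    leaves index 0 free, since one position does not affect recurrence; this accommodates the fresh
    initial state. *)
Lemma even_parity_monotone (r w w' : nat -> nat) (n : nat) :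
  (forall i, w i < n) -> {homo r : x y / x <= y} ->
  (forall i, odd (r (w i)) = odd (w i)) ->
  (forall i, 0 < i -> w' i = r (w i)) ->
  even_parity w <-> even_parity w'.
Proof.
move=> w_lt r_homo r_odd w'E.
have least_r p : least_infinitely_often w p ->
    least_infinitely_often w' (r p) /\ odd (r p) = odd p.
  move=> [io min]; split; last by have [i [_ <-]] := io 0.
  split=> [m|p' io'].
    have [i [lt wi]] := io m.+1; exists i.
    by rewrite w'E ?wi ?(ltnW lt) //; apply: leq_trans lt.
  have [|v [<- v_io]] := @infinitely_often_fiber r w n p' w_lt.
    move=> m; have [i [lt w'i]] := io' m.+1; exists i.
    by rewrite /= -w'E ?(ltnW lt) //; apply: leq_trans lt.
  exact: r_homo (min _ v_io).
split=> [[p [/least_r [least oddE] even]]|[p' [[io' min'] even]]].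
  by exists (r p); rewrite oddE.
(* As [w] is bounded it has a least recurring value [p]; then [r p] and [p'] are both least for
   [w'], hence equal. *)
have [p least] := least_infinitely_often_exists w_lt.
exists p; split=> //; have [[io min] <-] := least_r p least.
suff -> : r p = p' by [].
by apply/eqP; rewrite eqn_leq min //= min'.
Qed.

(** * Compressing priorities *)

(** [compress P] is the pointwise least order-preserving map that also preserves
    the parity of the elements of [P]. *)
Fixpoint compress (P : pred nat) (p : nat) : nat :=
  if p is p'.+1
  then compress P p' + (P p && (odd p != odd (compress P p')))
  else 0.

Lemma compress_homo (P : pred nat) : {homo compress P : x y / x <= y}.
Proof.
apply: homo_leq => // [y x z|p]; [exact: leq_trans|exact: leq_addr].
Qed.

Lemma odd_compress (P : pred nat) p : P p -> odd (compress P p) = odd p.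
Proof.
case: p => //= p ->; rewrite oddD /=.
by case: (odd p) (odd (compress P p)) => -[].
Qed.

(** Each increment is by one and occurs at an element of [P] between 1 and [p]. *)
Lemma compress_le (P : pred nat) p : compress P p <= count P (iota 1 p).
Proof.
elim: p => // p IH; rewrite -addn1 iotaD count_cat /= addn0 add1n addn1 /=.
by apply: leq_add => //; case: (P p.+1) => //=; case: (_ != _).
Qed.

Lemma compress_le_size (s : seq nat) p :
  compress (mem s) p <= size (undup s).
Proof.
apply: leq_trans (compress_le _ _) _; rewrite -size_filter.
apply: uniq_leq_size; first by rewrite filter_uniq ?iota_uniq.
by move=> x; rewrite mem_filter mem_undup => /andP[].
Qed.

Lemma num_prios_le (Sigma : finType) (A : aapta Sigma) n :
  (forall q : state A, prio q <= n) -> num_prios A <= n.+1.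
Proof.
move=> le; rewrite -[leqRHS](size_iota 0); apply: uniq_leq_size.
  exact: undup_uniq.
by move=> p; rewrite mem_undup mem_iota => /codomP[q ->]; rewrite ltnS le.
Qed.

(** * Relating execution trees along an embedding *)

Definition relabel (D Q R : Type) (h : Q -> R) (x : seq (D * Q)) : seq (D * R) :=
  [seq (p.1, h p.2) | p <- x].

Lemma relabel_rcons (D Q R : Type) (h : Q -> R) (x : seq (D * Q)) d q :
  relabel h (rcons x (d, q)) = rcons (relabel h x) (d, h q).
Proof. by rewrite /relabel map_rcons. Qed.

Lemma relabel_prefix (D Q R : eqType) (h : Q -> R) (x y : seq (D * Q)) :
  prefix x y -> prefix (relabel h x) (relabel h y).
Proof. by case/prefixP => z ->; rewrite /relabel map_cat prefix_prefix. Qed.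

(** The initial state of [B] may lie outside the range of [emb], so it is tied to that of [A]
    through [proj]. *)
Record embedding (Sigma : finType) (A B : aapta Sigma) := Embedding {
  emb : state A -> state B;
  proj : state B -> state A;
  embK : cancel emb proj;
  proj_init : proj (init B) = init A;
  trans_emb : forall q a, trans (emb q) a = lift emb (trans q a);
  rank : nat -> nat;
  rank_homo : {homo rank : x y / x <= y};
  odd_rank : forall q : state A, odd (rank (prio q)) = odd (prio q);
  prio_emb : forall q : state A, prio (emb q) = rank (prio q) }.

Lemma node_of_relabel (Sigma : finType) (A B : aapta Sigma) (D : finType)
    (h : state A -> state B) (x : seq (D * state A)) :
  node_of (relabel h x) = node_of x.
Proof. by rewrite /node_of /unzip1 -map_comp. Qed.

Lemma state_of_relabel (Sigma : finType) (A B : aapta Sigma) (D : finType)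
    (h : state A -> state B) (x : seq (D * state A)) :
  h (init A) = init B -> state_of (relabel h x) = h (state_of x).
Proof.
move=> hE; case/lastP: x => [|x [d q]]; first by rewrite /state_of /= hE.
by rewrite relabel_rcons /state_of /unzip2 !map_rcons !last_rcons.
Qed.

(** Serves for [emb], which need not preserve the initial state: a nonempty node takes its state
    from its last entry. *)
Lemma state_of_relabel_neq_nil (Sigma : finType) (A B : aapta Sigma) (D : finType)
    (h : state A -> state B) (x : seq (D * state A)) :
  x != [::] -> state_of (relabel h x) = h (state_of x).
Proof.
case/lastP: x => // x [d q] _.
by rewrite relabel_rcons /state_of /unzip2 !map_rcons !last_rcons.
Qed.

(** The type [successors t m] depends on [m]; defining [nu] on all directions allows transport along
    an equality of nodes. *)
Lemma successors_sat_cast (D S : finType) (t : set (seq D)) (m m' : seq D)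
    (nu : D -> set S) phi :
  m = m' ->
  marking_sat (fun d : successors t m => nu (val d)) phi ->
  marking_sat (fun d : successors t m' => nu (val d)) phi.
Proof. by move=> ->. Qed.

Lemma infinite_branch_neq_nil (D : finType) (t : set (seq D)) b i :
  infinite_branch t b -> 0 < i -> b i != [::].
Proof.
move=> [_ step]; case: i => // i _; have [_ [d ->]] := step i.
by rewrite -size_eq0 size_rcons.
Qed.

Lemma infinite_branch_prefix (D : finType) (t : set (seq D)) b i j :
  infinite_branch t b -> i <= j -> prefix (b i) (b j).
Proof.
move=> [_ step] /subnK <-; elim: (j - i) => [|k IH]; first exact: prefix_refl.
apply: prefix_trans IH _; have [_ [d ->]] := step (k + i).
exact: prefix_rcons.
Qed.

(** * Moving execution trees between the two automata *)

Section Embedding.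
Variables (Sigma : finType) (A B : aapta Sigma) (e : embedding A B).

Lemma prio_bound (w : nat -> state A) i :
  prio (w i) < (\max_(q : state A) prio q).+1.
Proof. by rewrite ltnS leq_bigmax. Qed.

Definition in_range (D : finType) (y : seq (D * state B)) : bool :=
  all (fun p => emb e (proj e p.2) == p.2) y.

Lemma in_range_relabelK (D : finType) (y : seq (D * state B)) :
  in_range y -> relabel (emb e) (relabel (proj e) y) = y.
Proof.
move=> /allP ran; rewrite /relabel -map_comp map_id_in // => -[d q] /ran /=.
by move=> /eqP ->.
Qed.

(** This is the image of [tau] under [emb], written as a preimage under [proj] so that no source
    node has to be chosen. *)
Definition push (D : finType) (tau : set (seq (D * state A))) :
    set (seq (D * state B)) :=
  [set y | in_range y /\ tau (relabel (proj e) y)]%classic.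

Lemma push_tree (D : finType) (tau : set (seq (D * state A))) :
  is_tree tau -> is_tree (push tau).
Proof.
move=> [root closed]; split=> // m n mn [ran taun]; split.
  by move: mn ran => /prefixP[z ->]; rewrite /in_range all_cat => /andP[].
exact: closed (relabel_prefix _ mn) taun.
Qed.

(** The use of [proj] covers the root too: there the initial constraint of [A] holds, whatever
    constraint [init B] carries. *)
Lemma push_sat (T : ltree Sigma) (tau : set (seq (dir T * state A))) y :
  execution_tree tau -> push tau y ->
  exists m : nodes T, val m = node_of y /\
    marking_sat (@succ_marking _ _ _ (nodes T) (push tau) y)
      (lift (emb e) (trans (proj e (state_of y)) (label m))).
Proof.
move=> [_ sat] [ran /sat [m [mE]]].
rewrite (state_of_relabel _ (proj_init e)) => {}sat.
exists m; rewrite mE node_of_relabel; split=> //.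
apply/marking_sat_lift; first exact: can_inj (embK e).
pose nu d q := push tau (rcons y (d, emb e q)).
apply: (@successors_sat_cast _ _ _ _ _ nu _ (node_of_relabel (proj e) y)).
apply: marking_sat_mono sat => d q; rewrite /succ_marking /nu => tauq; split.
  by rewrite /in_range all_rcons /= embK eqxx.
by rewrite relabel_rcons embK.
Qed.

Lemma trans_in_range (D : finType) (y : seq (D * state B)) a :
  in_range y -> y != [::] ->
  trans (state_of y) a = lift (emb e) (trans (proj e (state_of y)) a).
Proof.
case/lastP: y => // y [d q]; rewrite /in_range all_rcons => /andP[/eqP /= qE _] _.
by rewrite /state_of /unzip2 map_rcons last_rcons /= -trans_emb qE.
Qed.

Lemma infinite_branch_push (D : finType) (tau : set (seq (D * state A))) b :
  infinite_branch (push tau) b ->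
  infinite_branch tau (fun i => relabel (proj e) (b i)).
Proof.
move=> [b0 step]; split=> [|i]; first by rewrite b0.
have [[_ taub] [[d q] ->]] := step i; split=> //.
by exists (d, proj e q); rewrite relabel_rcons.
Qed.

Lemma push_accepting (D : finType) (tau : set (seq (D * state A))) :
  accepting tau -> accepting (push tau).
Proof.
move=> acc b br; have := acc _ (infinite_branch_push br).
apply: (iffLR (even_parity_monotone _ (rank_homo e) _ _)) => [i|i|i i_gt0].
- exact: (prio_bound (fun i => state_of (relabel (proj e) (b i)))).
- exact: odd_rank.
- have [_ /(_ i) [[ran _] _]] := br.
  rewrite -prio_emb -[in LHS](in_range_relabelK ran) state_of_relabel_neq_nil //.
  exact: infinite_branch_neq_nil (infinite_branch_push br) i_gt0.
Qed.

(** Keep only the nodes of [tau] whose states all lie in the range of [emb]. Lifted constraints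
    select such states only, so they survive the pruning; the root constraint is supplied as a
    hypothesis. *)
Lemma language_pull (T : ltree Sigma) (tau : set (seq (dir T * state B))) :
  execution_tree tau -> accepting tau ->
  (forall m : nodes T, val m = [::] ->
     marking_sat (@succ_marking _ B _ (nodes T) tau [::])
       (lift (emb e) (trans (init A) (label m)))) ->
  language A T.
Proof.
move=> [[root closed] sat] acc sat_root.
have emb_inj := can_inj (embK e).
pose tauA := [set x | tau (relabel (emb e) x)]%classic.
exists tauA; split.
  split; first by split=> // m n mn; apply: closed; apply: relabel_prefix.
  move=> x taux; have [m [mE satm]] := sat _ taux; exists m.
  have mE' : val m = node_of x by rewrite mE node_of_relabel.
  split=> //.
  pose nu d q := tauA (rcons x (d, q)).
  have nodeE := node_of_relabel (emb e) x.
  apply: (@successors_sat_cast _ _ _ _ _ nu _ nodeE).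
  have {satm} : marking_sat
      (@succ_marking _ _ _ (nodes T) tau (relabel (emb e) x))
      (lift (emb e) (trans (state_of x) (label m))).
    have [xE|x_neq] := eqVneq x [::].
      by subst x; apply: sat_root; rewrite mE'.
    by rewrite -trans_emb -state_of_relabel_neq_nil.
  move=> /marking_sat_lift-/(_ emb_inj); apply: marking_sat_mono => d q.
  by rewrite /succ_marking /nu /tauA /= relabel_rcons.
move=> b br.
have br' : infinite_branch tau (fun i => relabel (emb e) (b i)).
  have [b0 step] := br; split=> [|i]; first by rewrite b0.
  have [taub [[d q] ->]] := step i; split=> //.
  by exists (d, emb e q); rewrite relabel_rcons.
have := acc _ br'.
apply: (iffRL (even_parity_monotone _ (rank_homo e) _ _)) => [i|i|i i_gt0].
- exact: (prio_bound (fun i => state_of (b i))).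
- exact: odd_rank.
- rewrite -prio_emb state_of_relabel_neq_nil //.
  exact: infinite_branch_neq_nil br i_gt0.
Qed.

End Embedding.

(** * The combined automaton *)

Section Combine.
Variables (Sigma : finType) (A A' : aapta Sigma).

Definition sum_state : finType := option (state A + state A')%type.

Variable op : eu_constraint sum_state -> eu_constraint sum_state ->
  eu_constraint sum_state.

Definition in_left (q : state A) : sum_state := Some (inl q).
Definition in_right (q : state A') : sum_state := Some (inr q).

Definition compressed_prio (C : aapta Sigma) (q : state C) : nat :=
  compress (mem (codom (@prio _ C))) (prio q).

(** The priority of the fresh initial state is irrelevant: no infinite branch
    visits it twice. *)
Definition combine : aapta Sigma :=
  {| state := sum_state;
     init := None;
     trans := fun o a =>
       match o with
       | None => op (lift in_left (trans (init A) a))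
                    (lift in_right (trans (init A') a))
       | Some (inl q) => lift in_left (trans q a)
       | Some (inr q) => lift in_right (trans q a)
       end;
     prio := fun o =>
       match o with
       | None => 0
       | Some (inl q) => compressed_prio q
       | Some (inr q) => compressed_prio q
       end |}.

Lemma odd_compressed_prio (C : aapta Sigma) (q : state C) :
  odd (compressed_prio q) = odd (prio q).
Proof. exact: odd_compress (codom_f _ q). Qed.

Definition embed_left : embedding A combine :=
  @Embedding _ A combine in_left
    (fun o => if o is Some (inl q) then q else init A)
    (fun=> erefl) erefl (fun _ _ => erefl) _ (@compress_homo _)
    (@odd_compressed_prio A) (fun=> erefl).

Definition embed_right : embedding A' combine :=
  @Embedding _ A' combine in_right
    (fun o => if o is Some (inr q) then q else init A')
    (fun=> erefl) erefl (fun _ _ => erefl) _ (@compress_homo _)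
    (@odd_compressed_prio A') (fun=> erefl).

(** * Size of the combined automaton *)

Definition max_eu_pairs (F : forall S : finType, eu_pair S -> nat)
    (C : aapta Sigma) : nat :=
  \max_(q : state C) \max_(a : Sigma) \max_(p <- eu_pairs (trans q a)) F _ p.

(** One measure [F] treats both components of a pair. The root formula contains only lifted pairs of
    the two initial formulas, so a maximum suffices. *)
Lemma combine_pairs_le (F : forall S : finType, eu_pair S -> nat) :
  (forall (S R : finType) (f : S -> R) p, F R (lift_pair f p) <= F S p) ->
  (forall phi psi, eu_pairs (op phi psi) = eu_pairs phi ++ eu_pairs psi) ->
  max_eu_pairs F combine <= maxn (max_eu_pairs F A) (max_eu_pairs F A').
Proof.
move=> F_lift op_pairs.
have F_le (C : aapta Sigma) (q : state C) a (R : finType) (f : state C -> R) :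
    \max_(p <- eu_pairs (lift f (trans q a))) F R p <= max_eu_pairs F C.
  apply: (bigmax_sup q) => //; apply: (bigmax_sup a) => //.
  rewrite eu_pairs_lift big_map; elim/big_ind2: _ => // x1 x2 y1 y2 le1 le2.
  by rewrite geq_max !leq_max le1 le2 orbT.
apply/bigmax_leqP => o _; apply/bigmax_leqP => a _.
case: o => [[q|q]|] /=; last by rewrite op_pairs big_cat geq_max !leq_max !F_le orbT.
- exact: leq_trans (F_le _ _ _ _ _) (leq_maxl _ _).
- exact: leq_trans (F_le _ _ _ _ _) (leq_maxr _ _).
Qed.

(** The fresh state, the root connective and the range {0, ..., k} of compressed priorities each
    account for one extra unit. *)
Lemma combine_size :
  (forall phi psi, formula_size (op phi psi) =
     (formula_size phi + formula_size psi).+1) ->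
  (forall phi psi, eu_pairs (op phi psi) = eu_pairs phi ++ eu_pairs psi) ->
  size_at_most (aapta_size combine)
    (#|state A| + #|state A'| + 1,
     sizeB A + sizeB A' + 1,
     maxn (sizeE A) (sizeE A'),
     maxn (sizeU A) (sizeU A'),
     maxn (num_prios A) (num_prios A') + 1).
Proof.
move=> op_size op_pairs.
have B_le (C : aapta Sigma) (q : state C) a : formula_size (trans q a) <= sizeB C.
  by apply: (bigmax_sup q) => //; apply: (bigmax_sup a).
split.
- by rewrite card_option card_sum addn1.
- apply/bigmax_leqP => o _; apply/bigmax_leqP => a _.
  case: o => [[q|q]|] /=; rewrite ?op_size !formula_size_lift addn1.
  + exact: leq_trans (B_le A q a) (leqW (leq_addr _ _)).
  + exact: leq_trans (B_le A' q a) (leqW (leq_addl _ _)).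
  + by rewrite ltnS leq_add.
- apply: (combine_pairs_le (F := fun _ p => size (eu_E p))) => // S R f p.
  by rewrite size_lift_pair_E.
- apply: (combine_pairs_le (F := fun _ p => #|eu_U p|)) => // S R f p.
  exact: leq_imset_card.
- rewrite addn1; apply: num_prios_le => -[[q|q]|] //=.
  + exact: leq_trans (compress_le_size _ _) (leq_maxl _ _).
  + exact: leq_trans (compress_le_size _ _) (leq_maxr _ _).
Qed.

(** * Languages of the union and intersection automata *)

Lemma language_combine_pull (T : ltree Sigma)
    (tau : set (seq (dir T * state combine))) :
  execution_tree tau ->
  exists2 m : nodes T, val m = [::] &
    marking_sat (@succ_marking _ combine _ (nodes T) tau [::])
      (op (lift in_left (trans (init A) (label m)))
          (lift in_right (trans (init A') (label m)))).
Proof. by move=> [[root _] sat]; have [m [mE]] := sat _ root; exists m. Qed.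

End Combine.

Definition union_aapta (Sigma : finType) (A A' : aapta Sigma) : aapta Sigma :=
  combine (@EUOr (sum_state A A')).

Definition inter_aapta (Sigma : finType) (A A' : aapta Sigma) : aapta Sigma :=
  combine (@EUAnd (sum_state A A')).

(** The disjunct satisfied at the root tells which automaton to restrict to; conversely, a pushed
    execution tree satisfies its own disjunct. *)
Lemma language_union (Sigma : finType) (A A' : aapta Sigma) (T : ltree Sigma) :
  language (union_aapta A A') T <-> language A T \/ language A' T.
Proof.
split=> [[tau [exec acc]]|].
  have [m mE sat] := language_combine_pull exec.
  have uniq_m (m' : nodes T) : val m' = [::] -> m' = m.
    by rewrite -mE; apply: val_inj.
  case: sat => sat;
    [left; apply: (language_pull (e := embed_left (@EUOr _))) acc _
    |right; apply: (language_pull (e := embed_right (@EUOr _))) acc _] => //;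
    by move=> m' /uniq_m ->.
have main (C : aapta Sigma) (e : embedding C (union_aapta A A')) :
    (forall (S' : finType) (nu : marking S' _) a,
      marking_sat nu (lift (emb e) (trans (init C) a)) ->
      marking_sat nu (trans (init (union_aapta A A')) a)) ->
    language C T -> language (union_aapta A A') T.
  move=> root_sat [tau [exec acc]]; exists (push e tau).
  split; last exact: push_accepting.
  split; first exact: push_tree exec.1.
  move=> y pushy; have [m [mE sat]] := push_sat exec pushy; exists m; split=> //.
  have [yE|y_neq] := eqVneq y [::]; last by rewrite (trans_in_range _ pushy.1).
  by subst y; apply: root_sat; rewrite -(proj_init e).
by case; [apply: (main _ (embed_left (@EUOr (sum_state A A')))); left
  |apply: (main _ (embed_right (@EUOr (sum_state A A')))); right].
Qed.

(** The ranges are disjoint, so the two pushed trees share only the root: the first step of a branch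
    decides its tree, and prefix closure keeps it there. *)
Lemma infinite_branch_setU_push (Sigma : finType) (A A' B : aapta Sigma)
    (e : embedding A B) (e' : embedding A' B) (D : finType)
    (tau : set (seq (D * state A))) (tau' : set (seq (D * state A'))) b :
  (forall q q', emb e q != emb e' q') ->
  is_tree (push e tau) -> is_tree (push e' tau') ->
  infinite_branch (push e tau `|` push e' tau')%classic b ->
  infinite_branch (push e tau) b \/ infinite_branch (push e' tau') b.
Proof.
move=> disj [root closed] [root' closed'] br; have [b0 step] := br.
have b_in_pref i : 0 < i -> prefix (b 1) (b i).
  by move=> i_gt0; apply: infinite_branch_prefix br i_gt0.
have not_both : push e tau (b 1) -> push e' tau' (b 1) -> False.
  have [_ [[d q] ->]] := step 0; rewrite b0 => -[/= + _] [/= + _].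
  rewrite /in_range /= !andbT => /eqP qE /eqP q'E.
  by have := disj (proj e q) (proj e' q); rewrite qE q'E eqxx.
have [[in1|in1] _] := step 1; [left|right];
  split=> // i; split; try exact: (step i).2.
- have [->|i_gt0] := posnP i; first by rewrite b0.
  have [[//|in'] _] := step i; case: not_both => //.
  exact: closed' (b_in_pref _ i_gt0) in'.
- have [->|i_gt0] := posnP i; first by rewrite b0.
  have [[in'|//] _] := step i; case: not_both => //.
  exact: closed (b_in_pref _ i_gt0) in'.
Qed.

(** One execution tree restricts to both components. Conversely, the union of the two pushed trees
    works: its root has the successors of both, and enlarging a marking preserves satisfaction. *)
Lemma language_inter (Sigma : finType) (A A' : aapta Sigma) (T : ltree Sigma) :
  language (inter_aapta A A') T <-> language A T /\ language A' T.
Proof.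
split=> [[tau [exec acc]]|].
  have [m mE [sat sat']] := language_combine_pull exec.
  have uniq_m (m' : nodes T) : val m' = [::] -> m' = m.
    by rewrite -mE; apply: val_inj.
  split; [apply: (language_pull (e := embed_left (@EUAnd _))) acc _
    |apply: (language_pull (e := embed_right (@EUAnd _))) acc _] => //;
    by move=> m' /uniq_m ->.
move=> [[tau [exec acc]] [tau' [exec' acc']]].
set e := embed_left (@EUAnd (sum_state A A')).
set e' := embed_right (@EUAnd (sum_state A A')).
have tree := push_tree e exec.1; have tree' := push_tree e' exec'.1.
exists (push e tau `|` push e' tau')%classic; split; last first.
  move=> b /infinite_branch_setU_push []// => br.
  - exact: push_accepting acc _ br.
  - exact: push_accepting acc' _ br.
split.
  split; first by left; exact: tree.1.
  move=> m n mn [taun|taun]; [left|right].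
  - exact: tree.2 mn taun.
  - exact: tree'.2 mn taun.
have subL y : forall d q,
    @succ_marking _ (combine _) _ (nodes T) (push e tau) y d q ->
    @succ_marking _ (combine _) _ (nodes T) (push e tau `|` push e' tau')%classic
      y d q by left.
have subR y : forall d q,
    @succ_marking _ (combine _) _ (nodes T) (push e' tau') y d q ->
    @succ_marking _ (combine _) _ (nodes T) (push e tau `|` push e' tau')%classic
      y d q by right.
move=> y; have [-> _|y_neq] := eqVneq y [::].
  have [m [mE sat]] := push_sat exec tree.1.
  have [m' [m'E sat']] := push_sat exec' tree'.1.
  (* Both initial constraints must be read at the same node, the root of [T]. *)
  have mm' : m' = m by apply: val_inj; rewrite mE.
  exists m; split=> //; split.
    exact: marking_sat_mono (subL _) sat.
  by rewrite -mm'; exact: marking_sat_mono (subR _) sat'.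
move=> [pushy|pushy].
- have [m [mE sat]] := push_sat exec pushy; exists m; split=> //.
  by rewrite (trans_in_range _ pushy.1) //; exact: marking_sat_mono (subL _) sat.
- have [m [mE sat]] := push_sat exec' pushy; exists m; split=> //.
  by rewrite (trans_in_range _ pushy.1) //; exact: marking_sat_mono (subR _) sat.
Qed.

Theorem theorem1 (Sigma : finType) (A A' : aapta Sigma) :
  let bound : nat * nat * nat * nat * nat :=
    (#|state A| + #|state A'| + 1,
     sizeB A + sizeB A' + 1,
     maxn (sizeE A) (sizeE A'),
     maxn (sizeU A) (sizeU A'),
     maxn (num_prios A) (num_prios A') + 1) in
  exists Acup Acap : aapta Sigma,
    (forall T : ltree Sigma, language Acup T <-> language A T \/ language A' T) /\
    (forall T : ltree Sigma, language Acap T <-> language A T /\ language A' T) /\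
    size_at_most (aapta_size Acup) bound /\
    size_at_most (aapta_size Acap) bound.
Proof.
exists (union_aapta A A'), (inter_aapta A A').
split; first exact: language_union.
split; first exact: language_inter.
by split; apply: combine_size.
Qed.
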